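(* Let $H$ be a finite simple connected graph with at least one edge, and let $S(H)$ be the set of proper labelings of $H$. For $f\in S(H)$ let $T_f(H)$ be the monotone-path tree of $H$ and let $\lambda(T_f(H))$ be the largest eigenvalue of its adjacency matrix. Then $$d_{crit}(H)\ \ge\ \max_{f\in S(H)}\left\{1-\frac{1}{\lambda(T_f(H))^2}\right\}.$$
   Context: A proper labeling of a graph $H$ on $n$ vertices is a bijection $f:\{1,\dots,n\}\to V(H)$ such that $\{f(1),\dots,f(k)\}$ induces a connected subgraph of $H$ for all $1\le k\le n$. The monotone-path tree $T_f(H)$ has as vertices the paths $f(i_1)f(i_2)\cdots f(i_k)$ of $H$ ($k\ge1$) with $1=i_1<i_2<\dots<i_k$; two such paths are adjacent if one is the extension of the other by exactly one new (last) vertex. A weighted blow-up graph $G[H]$ of $H$ is a graph whose vertex set is the disjoint union of finite nonempty clusters $A_v$ ($v\in V(H)$), whose edges only join vertices of $A_u$ to vertices of $A_v$ with $uv\in E(H)$ (not necessarily all such pairs), together with non-negative vertex weights $w$ such that the total weight of each cluster is $1$. For $uv\in E(H)$ the density is $d(A_u,A_v)=\sum w(x)w(y)$, the sum running over all edges $xy$ of $G[H]$ with $x\in A_u$, $y\in A_v$. $G[H]$ contains $H$ as a transversal if one can choose $\varphi(v)\in A_v$ for every $v\in V(H)$ such that $\varphi(u)\varphi(v)\in E(G[H])$ for every $uv\in E(H)$. The critical edge density $d_{crit}(H)$ is the supremum of all $d\in[0,1]$ for which there is a weighted blow-up graph of $H$ with $d(A_u,A_v)\ge d$ for all $uv\in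 E(H)$ that does not contain $H$ as a transversal. *)

(* Defs.v *)
From HB Require Import structures.
From mathcomp Require Import all_boot all_order all_algebra.
From mathcomp Require Import boolp classical_sets reals constructive_ereal.

Set Implicit Arguments.
Unset Strict Implicit.
Unset Printing Implicit Defensive.

Import Order.TTheory GRing.Theory Num.Theory.

Local Open Scope ring_scope.

Record sgraph := SGraph {
  vertex :> finType;
  adj : rel vertex;
  adj_sym : symmetric adj;
  adj_irr : irreflexive adj
}.

Definition connected_graph (G : sgraph) : Prop :=
  forall x y : G, connect (@adj G) x y.

Section Induced.
Variables (G : sgraph) (A : {set G}).

Definition induced_rel : rel {x : G | x \in A} :=
  fun x y => adj (val x) (val y).

Lemma induced_sym : symmetric induced_rel.
Proof. by move=> x y; rewrite /induced_rel adj_sym. Qed.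

Lemma induced_irr : irreflexive induced_rel.
Proof. by move=> x; rewrite /induced_rel adj_irr. Qed.

Definition induced : sgraph := SGraph induced_sym induced_irr.

End Induced.

(* Labels are shifted by one: the label i of 1, ..., n is the ordinal i - 1,
   so the first k labels are the ordinals smaller than k. *)
Definition labeling (H : sgraph) := {ffun 'I_#|H| -> H}.

Definition proper_labeling (H : sgraph) (f : labeling H) : Prop :=
  bijective f /\
  forall k : nat, (1 <= k <= #|H|)%N ->
    connected_graph (induced [set f i | i : 'I_#|H| & (i < k)%N]).

Section MonotonePathTree.
Variables (H : sgraph) (f : labeling H).

(* The path f(i_1) ... f(i_k) is encoded by its sequence of labels
   [:: i_1; ...; i_k], which determines it when f is injective; a strictly
   increasing sequence of labels has size at most #|H|. *)
Definition monotone_path (s : #|H|.-bseq 'I_#|H|) : bool :=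
  [&& ohead (map val s) == Some 0%N,
      sorted ltn (map val s) &
      sorted (@adj H) (map f s)].

Definition extends (s t : seq 'I_#|H|) : bool :=
  [exists i, t == rcons s i].

Definition tree_rel : rel {s : #|H|.-bseq 'I_#|H| | monotone_path s} :=
  fun s t => extends (val s) (val t) || extends (val t) (val s).

Lemma tree_sym : symmetric tree_rel.
Proof. by move=> s t; rewrite /tree_rel orbC. Qed.

Lemma tree_irr : irreflexive tree_rel.
Proof.
move=> s; rewrite /tree_rel orbb; apply/negbTE/existsP => -[i /eqP /(congr1 size)].
by rewrite size_rcons => /eqP; rewrite ltn_eqF.
Qed.

Definition monotone_path_tree : sgraph := SGraph tree_sym tree_irr.

End MonotonePathTree.

Definition adjacency_matrix (R : realType) (G : sgraph) : 'M[R]_#|G| :=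
  \matrix_(i, j) (adj (enum_val i) (enum_val j))%:R.

(* The spectrum is finite, and nonempty when G has a vertex (the adjacency
   matrix being symmetric), so that the supremum is then a maximum. *)
Definition largest_eigenvalue (R : realType) (G : sgraph) : R :=
  sup [set a : R | eigenvalue (adjacency_matrix R G) a]%classic.

(* The cluster A_v is the fibre of [cluster] above v. *)
Record weighted_blowup (R : realType) (H : sgraph) := WeightedBlowup {
  blowup_graph :> sgraph;
  cluster : blowup_graph -> H;
  weight : blowup_graph -> R;
  cluster_nonempty : forall v : H, exists x : blowup_graph, cluster x = v;
  blowup_adj : forall x y : blowup_graph,
    adj x y -> adj (cluster x) (cluster y);
  weight_ge0 : forall x : blowup_graph, 0 <= weight x;
  weight_cluster : forall v : H, \sum_(x | cluster x == v) weight x = 1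
}.

Definition density (R : realType) (H : sgraph) (B : weighted_blowup R H)
    (u v : H) : R :=
  \sum_(x : B | cluster x == u) \sum_(y : B | (cluster y == v) && adj x y)
    weight x * weight y.

Definition has_transversal (R : realType) (H : sgraph)
    (B : weighted_blowup R H) : Prop :=
  exists phi : H -> B,
    (forall v : H, cluster (phi v) = v) /\
    (forall u v : H, adj u v -> adj (phi u) (phi v)).

Definition dcrit (R : realType) (H : sgraph) : R :=
  sup [set d : R | 0 <= d <= 1 /\
    exists B : weighted_blowup R H,
      (forall u v : H, adj u v -> d <= density B u v) /\
      ~ has_transversal B]%classic.

(* Main.v *)
Require Import Defs.
From HB Require Import structures.
From mathcomp Require Import all_boot all_order all_algebra.
From mathcomp Require Import boolp classical_sets reals constructive_ereal.
From mathcomp Require Import topology normedtype.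
From mathcomp Require Import lra.

Set Implicit Arguments.
Unset Strict Implicit.
Unset Printing Implicit Defensive.

Import Order.TTheory GRing.Theory Num.Theory.
Import numFieldNormedType.Exports.

Local Open Scope ring_scope.

(** The bound is proved for one proper labeling f at a time, by a construction
in which the same numbers describe both the blow-up and the eigenvector of the
tree. Orient every edge of H towards its larger label (the relation [up]), so
that the label 0, the root r, is the only source. Let s be a positive real and
t a function on labels such that
    t r = 0,   t i > 0 for i <> r,   t i + \sum_(j | up i j) s / t j = 1.

The blow-up. Split the cluster of f i into one point (i, None) of weight t i and
one point (i, Some j) of weight s / t j for each j above i; the total is 1 by
the equation. Points of positive weight over an edge of H are adjacent, except
that (i, Some j) is never adjacent to (j, None). Exactly one pair is missing
over each edge and its weight is (s / t j) * t j = s, so that every density is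
1 - s. A transversal cannot use (r, None), of weight 0, hence uses some
(r, Some j), hence some point (j, Some k), and so on: it would climb for ever
([density_up], [slack_blowup_no_transversal]).

The tree. With lam = s^(-1/2), give the monotone path r i_1 ... i_k the weight
\prod_m 1 / (lam * t i_m). At a node ending with i, the children contribute
(1 - t i) * lam times the weight of the node and the parent contributes
t i * lam times that weight, also at the root, where t r = 0 makes up for the
missing parent. So this is a positive eigenvector for lam, and an eigenvalue of
a nonnegative matrix which has a positive eigenvector bounds all the others:
lam is the largest eigenvalue ([largest_eigenvalue_tree]), and
1 - s = 1 - 1 / lam^2.

Existence of s and t. For given s the equation determines t from the top label
downwards. Increase s from 0, where t is constantly 1, to the supremum of the
values at which all t i are positive. There some t i vanishes by continuity, and
it can only be t r, because a vertex i with a predecessor satisfies t i > s as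
long as t is positive ([exists_slack_root]). *)

(** * The recursion along an acyclic orientation *)

Lemma sup_limit (R : realType) (S : set R) (h : R -> R) : has_sup S ->
  {for sup S, continuous h} -> (forall s, S s -> 0 <= h s) -> 0 <= h (sup S).
Proof.
move=> supS ch hS; rewrite leNgt; apply/negP => h_lt0.
have /nbhs_ballP[e /= e0 He] : \forall s \near sup S, h s < 0.
  exact: (@cvgr_lt _ _ (nbhs (sup S)) _ h (h (sup S))).
have [s Ss lts] := sup_adherent e0 supS.
have := hS s Ss; rewrite leNgt He // /ball /= ger0_norm; first by lra.
by rewrite subr_ge0 ub_le_sup //; case: supS.
Qed.

(** Ranks bounded by [n] that increase along [up] make [up] acyclic; [n] also
serves as the fuel of the recursion below. *)
Section Slack.
Variables (R : realType) (V : finType) (up : rel V) (rank : V -> nat) (n : nat).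
Hypothesis rank_lt : forall v, (rank v < n)%N.
Hypothesis up_rank : forall u v, up u v -> (rank u < rank v)%N.

(** Induction from the sinks of [up] down to its sources. *)
Lemma up_ind (P : V -> Prop) :
  (forall v, (forall w, up v w -> P w) -> P v) -> forall v, P v.
Proof.
move=> IH v; have [k] := ubnP (n - rank v).
elim: k v => // k IHk v; rewrite ltnS => lek; apply: IH => w /up_rank ltw.
by apply: IHk; apply: leq_trans lek; rewrite ltn_sub2l.
Qed.

Fixpoint slack_rec (k : nat) (s : R) (v : V) : R :=
  if k is k'.+1 then 1 - \sum_(w | up v w) s / slack_rec k' s w else 1.

Lemma slack_rec_fuel s k1 k2 v : (n - rank v <= k1)%N -> (n - rank v <= k2)%N ->
  slack_rec k1 s v = slack_rec k2 s v.
Proof.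
elim: k1 k2 v => [|k1 IHk] [|k2] v;
  rewrite ?leqn0 ?subn_eq0 1?[(n <= _)%N]leqNgt ?rank_lt //.
move=> le1 le2 /=; congr (1 - _); apply: eq_bigr => w /up_rank ltw.
by rewrite (IHk k2) // -ltnS; [apply: leq_trans le1 | apply: leq_trans le2];
  rewrite ltn_sub2l.
Qed.

(** The weight left for (v, None) when every (v, Some w) gets the weight
required for a missing pair of total weight [s]. *)
Definition slack (s : R) (v : V) : R := slack_rec n s v.

Lemma slackE s v : slack s v = 1 - \sum_(w | up v w) s / slack s w.
Proof.
by rewrite {1}/slack (@slack_rec_fuel s n n.+1) ?leq_subr ?leqW ?leq_subr.
Qed.

Lemma slack0 v : slack 0 v = 1.
Proof. by rewrite slackE big1 ?subr0 // => w _; rewrite mul0r. Qed.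

Lemma slack_le s u v : 0 <= s -> (forall w, up u w -> 0 < slack s w) ->
  up u v -> slack s u <= 1 - s / slack s v.
Proof.
move=> s0 pos uv; rewrite slackE lerB // (bigD1 v) //= lerDl.
by apply: sumr_ge0 => w /andP[/pos/ltW w0 _]; rewrite divr_ge0.
Qed.

Lemma slack_le1 s v : 0 <= s -> (forall w, up v w -> 0 < slack s w) ->
  slack s v <= 1.
Proof.
move=> s0 pos; rewrite slackE gerBl sumr_ge0 // => w /pos/ltW w0.
by rewrite divr_ge0.
Qed.

(** The slack of a predecessor [u] is at most [1 - s / slack s v], and it is
positive. This bound survives in the limit and keeps all vertices but the
source away from 0. *)
Lemma slack_gt s u v : 0 <= s -> (forall w, 0 < slack s w) ->
  up u v -> s < slack s v.
Proof.
move=> s0 pos uv; have := slack_le s0 (fun w _ => pos w) uv.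
by move=> /(lt_le_trans (pos u)); rewrite subr_gt0 ltr_pdivrMr // mul1r.
Qed.

Lemma slack_continuous s v :
  (forall w, up v w -> slack s w != 0 /\ {for s, continuous (slack^~ w)}) ->
  {for s, continuous (slack^~ v)}.
Proof.
move=> IH; rewrite /prop_for /continuous_at.
under eq_fun do rewrite slackE.
rewrite slackE; apply: cvgB; first exact: cvg_cst.
apply: (@cvg_big R _ _ _ _ (@add_continuous R) _ (nbhs s) _
  (fun w x => x / slack x w)) => w vw; have [w0 cw] := IH w vw.
by apply: cvgM; [exact: cvg_id | apply: cvgV].
Qed.

Lemma slack_pos_continuous s : (forall v, (exists u, up u v) -> slack s v != 0) ->
  forall v, {for s, continuous (slack^~ v)}.
Proof.
move=> s0; apply: up_ind => v IH; apply: slack_continuous => w vw.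
by split; [apply: s0; exists v | apply: IH].
Qed.

(** This provides both the positivity of the supremum (from s = 0) and the
contradiction at the supremum. *)
Lemma slack_pos_open s : (forall v, 0 < slack s v) ->
  exists2 s', s < s' & forall v, 0 < slack s' v.
Proof.
move=> pos.
have : \forall s' \near s, forall v : V, 0 < slack s' v.
  apply: (@filter_forall R V (fun v s' => 0 < slack s' v) (nbhs s)) => v.
  apply: (@cvgr_gt _ _ (nbhs s) _ (slack^~ v) (slack s v)) => //.
  by apply: slack_pos_continuous => w _; rewrite gt_eqF.
move=> /nbhs_ballP[e /= e0 He]; exists (s + e / 2); first by rewrite ltrDl divr_gt0.
by apply: He; rewrite /ball /= opprD addNKr normrN gtr0_norm ?divr_gt0 //; lra.
Qed.

Variable r : V.
Hypothesis has_pred : forall v, v != r -> exists u, up u v.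
Hypothesis no_pred : forall u, ~~ up u r.
Hypothesis has_succ : exists v, up r v.

(** The value [s] is the supremum of the set of those for which all slacks are
positive. At the supremum the slack of [r] must vanish, for otherwise all slacks
would be positive there, hence also slightly beyond. *)
Lemma exists_slack_root : exists s,
  [/\ 0 < s <= 1, slack s r = 0 & forall v, v != r -> 0 < slack s v].
Proof.
have succ_neq u v (uv : up u v) : v != r.
  by apply: contraTneq uv => ->.
pose S := [set s : R | 0 <= s /\ forall v, 0 < slack s v]%classic.
have S0 : S 0 by split=> // v; rewrite slack0.
have Sle1 s : S s -> s <= 1.
  move=> [s0 pos]; have [v rv] := has_succ.
  by rewrite ltW // (lt_le_trans (slack_gt s0 pos rv)) // slack_le1.
have supS : has_sup S by split; [exists 0 | exists 1 => s /Sle1].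
set s0 := sup S.
have Sle s : S s -> s <= s0 by move=> Ss; apply: ub_le_sup Ss; case: supS.
have s0_gt0 : 0 < s0.
  have [|s s_gt0 pos] := @slack_pos_open 0; first by move=> v; rewrite slack0.
  by rewrite (lt_le_trans s_gt0) // Sle //; split=> //; apply: ltW.
(* Continuity at s0 needs the slacks above v to be nonzero, which in turn comes
   from continuity above v: both are proved together, from the top. *)
have lim v : {for s0, continuous (slack^~ v)} /\ (v != r -> s0 <= slack s0 v).
  move: v; apply: up_ind => v IH.
  have cv : {for s0, continuous (slack^~ v)}.
    apply: slack_continuous => w vw; have [cw le_w] := IH w vw; split=> //.
    by rewrite gt_eqF // (lt_le_trans s0_gt0) // le_w // (succ_neq v).
  split=> // vr; rewrite -subr_ge0.
  apply: (sup_limit supS) (cvgB cv cvg_id) _ => s [s_ge0 pos].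
  by have [u uv] := has_pred vr; rewrite /= subr_ge0 ltW // (slack_gt _ _ uv).
have pos v : v != r -> 0 < slack s0 v.
  by move=> vr; rewrite (lt_le_trans s0_gt0) //; case: (lim v) => _; apply.
exists s0; split=> //; first by rewrite s0_gt0 ge_sup //; exists 0.
apply/eqP; have ge0 : 0 <= slack s0 r.
  by apply: (sup_limit supS (lim r).1) => s [_ pos_s]; apply: ltW.
rewrite eq_le ge0 andbT leNgt; apply/negP => r_gt0.
have [|s lts pos'] := @slack_pos_open s0.
  by move=> v; have [->|/pos] := eqVneq v r.
have : s <= s0 by apply: Sle; split=> //; apply: ltW (lt_trans s0_gt0 lts).
by rewrite leNgt lts.
Qed.

End Slack.

(** * The largest eigenvalue of the monotone-path tree *)

(** The elementary half of the Perron-Frobenius theorem: compare the two sides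
of the equation for another eigenvector x at an index i that maximises the ratio
|x i| / y i. *)
Lemma positive_eigenvector_bound (R : realType) (m : nat) (A : 'M[R]_m)
    (y : 'rV[R]_m) (lam : R) :
  (forall i j, 0 <= A i j) -> (forall j, 0 < y 0 j) -> y *m A = lam *: y ->
  forall a, eigenvalue A a -> `|a| <= lam.
Proof.
move=> A0 y0 yA a /eigenvalueP[x xA /rV0Pn[j0 xj0]].
pose i := [arg max_(i > j0) (`|x 0 i| / y 0 i)]%O.
have max_i j : `|x 0 j| <= `|x 0 i| / y 0 i * y 0 j.
  by rewrite -ler_pdivrMr // /i; case: arg_maxP => // k _; apply.
have xi : 0 < `|x 0 i|.
  rewrite -(@pmulr_lgt0 _ (y 0 j0 / y 0 i)) ?divr_gt0 //.
  by rewrite mulrCA mulrC (lt_le_trans _ (max_i j0)) // normr_gt0.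
rewrite -(ler_pM2r xi) -normrM.
have /rowP/(_ i) := xA; rewrite !mxE => <-.
apply: le_trans (ler_norm_sum _ _ _) _.
have -> : lam * `|x 0 i| = \sum_j `|x 0 i| / y 0 i * y 0 j * A j i.
  under eq_bigr do rewrite -mulrA.
  have /rowP/(_ i) := yA; rewrite !mxE -mulr_sumr => ->.
  by rewrite mulrCA mulfVK // gt_eqF.
by apply: ler_sum => j _; rewrite normrM (ger0_norm (A0 _ _)) ler_wpM2r.
Qed.

(** The eigenvalue of a positive eigenfunction is both an upper bound of the
spectrum and one of its elements, hence its supremum. *)
Lemma largest_eigenvalueE (R : realType) (G : sgraph) (y : G -> R)
    (lam : R) (x0 : G) :
  (forall x, 0 < y x) ->
  (forall x, \sum_(z | adj z x) y z = lam * y x) ->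
  largest_eigenvalue R G = lam.
Proof.
move=> y0 yE; pose v : 'rV[R]_#|G| := \row_i y (enum_val i).
have vA : v *m adjacency_matrix R G = lam *: v.
  apply/rowP => i; rewrite !mxE -yE [RHS]big_mkcond.
  rewrite [RHS](reindex_onto enum_val enum_rank) /=.
    apply: eq_big => [j|j _]; first by rewrite enum_valK eqxx.
    by rewrite !mxE; case: ifP => _; rewrite ?mulr1 ?mulr0.
  by move=> z _; rewrite enum_rankK.
have ub a : eigenvalue (adjacency_matrix R G) a -> a <= lam.
  move=> ea; apply: le_trans (ler_norm a) _.
  by apply: positive_eigenvector_bound vA _ ea => [i j|j]; rewrite mxE.
have ev : eigenvalue (adjacency_matrix R G) lam.
  apply/eigenvalueP; exists v => //; apply/rV0Pn; exists (enum_rank x0).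
  by rewrite mxE enum_rankK gt_eqF.
apply/eqP; rewrite eq_le /largest_eigenvalue ge_sup; last by [].
- by rewrite ub_le_sup //; exists lam => a /ub.
- by exists lam.
Qed.

Definition up (H : sgraph) (f : labeling H) : rel 'I_#|H| :=
  fun i j => (i < j)%N && adj (f i) (f j).

Lemma up_lt (H : sgraph) (f : labeling H) i j : up f i j -> (i < j)%N.
Proof. by case/andP. Qed.

Section Tree.
Variables (R : realType) (H : sgraph) (f : labeling H).
Variables (t : 'I_#|H| -> R) (lam : R) (r : 'I_#|H|).
Hypothesis r_first : val r = 0%N.
Local Notation node := (monotone_path_tree f).
Local Notation labels Q := (bseqval (@proj1_sig (#|H|.-bseq 'I_#|H|) _ Q)).

Lemma monotone_pathE (s : #|H|.-bseq 'I_#|H|) :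
  monotone_path f s = (ohead (map val s) == Some 0%N) && sorted (up f) s.
Proof. by rewrite /monotone_path !sorted_map -sorted_relI. Qed.

Lemma node_labels (Q : node) : exists2 q, labels Q = r :: q & path (up f) r q.
Proof.
case: Q => s /= ms; move: (ms); rewrite monotone_pathE.
case: (bseqval s) => [|i q] //= /andP[/eqP[i0]].
have -> : i = r by apply: val_inj; rewrite r_first.
by exists q.
Qed.

Lemma node_of_path q : path (up f) r q -> exists Q : node, labels Q = r :: q.
Proof.
move=> rq; have uniq_q : uniq (r :: q).
  apply: (@sorted_uniq _ (relpre val ltn)) => [x y z|x|] /=; first exact: ltn_trans.
    by rewrite ltnn.
  by apply: sub_path rq => i j /andP[].
have size_q : (size (r :: q) <= #|H|)%N.
  by rewrite -(card_uniqP uniq_q) -[leqRHS]card_ord max_card.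
have mp : monotone_path f (Bseq size_q) by rewrite monotone_pathE /= r_first eqxx.
by exists (exist (fun s : #|H|.-bseq 'I_#|H| => monotone_path f s) _ mp).
Qed.

(** Sums over nodes become sums over label sequences: the path condition also
implies the bound on the size, so it alone decides whether there is a node. *)
Lemma sum_node (F : seq 'I_#|H| -> R) q :
  \sum_(Q : node | labels Q == r :: q) F (labels Q) =
  if path (up f) r q then F (r :: q) else 0.
Proof.
case: ifPn => [/node_of_path[Q0 Q0E]|no_path].
  rewrite (big_pred1 Q0) ?Q0E // => Q.
  by rewrite /= -Q0E -[RHS](inj_eq val_inj) -[RHS](inj_eq val_inj).
rewrite big_pred0 // => Q; apply: contraNF no_path => /eqP QE.
by have [q' + ?] := node_labels Q; rewrite QE => -[->].
Qed.

Hypothesis lam_gt0 : 0 < lam.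
Hypothesis t_root : t r = 0.
Hypothesis t_gt0 : forall i, i != r -> 0 < t i.
Hypothesis t_rec : forall i, t i + \sum_(j | up f i j) lam ^- 2 / t j = 1.

(** The factor of the root, first in every path, is left out since [t r = 0]. *)
Definition path_weight (s : seq 'I_#|H|) : R :=
  \prod_(i <- behead s) (lam * t i)^-1.

Lemma path_weight_rcons q j :
  path_weight (rcons (r :: q) j) = path_weight (r :: q) / (lam * t j).
Proof. by rewrite /path_weight /= -cats1 big_cat big_seq1. Qed.

Lemma path_weight_gt0 (Q : node) : 0 < path_weight (labels Q).
Proof.
have [q -> rq] := node_labels Q; rewrite /path_weight /= big_seq.
apply: prodr_gt0 => i iq; rewrite invr_gt0 mulr_gt0 // t_gt0 //.
have: all (relpre val ltn r) q.
  apply: (@order_path_min _ (relpre val ltn)) => [x y z|]; first exact: ltn_trans.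
  by apply: sub_path rq => j k /andP[].
by move=> /allP/(_ i iq) /=; apply: contraTneq => ->; rewrite ltnn.
Qed.

Lemma up_neq i j : up f i j -> j != r.
Proof. by case/andP=> ij _; apply: contraTneq ij => ->; rewrite r_first. Qed.

Lemma sum_children (Q : node) q : labels Q = r :: q -> path (up f) r q ->
  \sum_(P : node | extends (labels Q) (labels P)) path_weight (labels P) =
  path_weight (labels Q) * \sum_(j | up f (last r q) j) (lam * t j)^-1.
Proof.
move=> QE rq.
transitivity (\sum_j \sum_(P : node | labels P == rcons (labels Q) j)
                path_weight (labels P)); last first.
  rewrite mulr_sumr [RHS]big_mkcond; apply: eq_bigr => j _.
  rewrite QE rcons_cons (sum_node path_weight) rcons_path rq /=.
  by case: ifP => // _; rewrite -rcons_cons path_weight_rcons.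
rewrite (exchange_big_dep xpredT) //= [LHS]big_mkcond; apply: eq_bigr => P _.
case: ifPn => [/existsP[j /eqP PE]|noP].
  by rewrite (big_pred1 j) // => k; rewrite PE eqseq_rcons eqxx eq_sym.
by rewrite big_pred0 // => j; apply: contraNF noP => PE; apply/existsP; exists j.
Qed.

(** At the root both sides vanish: there is no parent, and [t r = 0]. *)
Lemma sum_parent (Q : node) q : labels Q = r :: q -> path (up f) r q ->
  \sum_(P : node | extends (labels P) (labels Q)) path_weight (labels P) =
  path_weight (labels Q) * (lam * t (last r q)).
Proof.
move=> -> ; case/lastP: q => [|q k] rq.
  rewrite t_root !mulr0 big_pred0 // => P; apply/existsP => -[i].
  by have [q -> _] := node_labels P; case: q => [|? ?] /eqP.
transitivity (\sum_(P : node | labels P == r :: q) path_weight (labels P)).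
  apply: eq_bigl => P; apply/existsP/eqP => [[i]|->].
    by rewrite -rcons_cons eqseq_rcons => /andP[/eqP].
  by exists k.
move: rq; rewrite (sum_node path_weight) rcons_path last_rcons => /andP[-> /up_neq].
rewrite -rcons_cons path_weight_rcons => /t_gt0 tk.
by rewrite mulfVK // gt_eqF // mulr_gt0.
Qed.

Lemma path_weight_eigen (Q : node) :
  \sum_(P : node | adj P Q) path_weight (labels P) = lam * path_weight (labels Q).
Proof.
have [q QE rq] := node_labels Q.
rewrite (bigID (fun P : node => extends (labels Q) (labels P))) /=.
rewrite (eq_bigl (fun P : node => extends (labels Q) (labels P))); last first.
  move=> P; rewrite /= /tree_rel andb_orl andbb orbC.
  by case: extends => //=; rewrite ?andbF.
rewrite (sum_children QE rq).
rewrite (eq_bigl (fun P : node => extends (labels P) (labels Q))); last first.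
  move=> P /=; rewrite /tree_rel andb_orl andbN orbF.
  case: (boolP (extends (labels P) _)) => //= /existsP[i /eqP Qi].
  apply/existsP => -[j /eqP Pj]; move: (congr1 size Pj).
  by rewrite Qi !size_rcons => /eqP; rewrite -addn2 -[X in X == _]addn0 eqn_add2l.
rewrite (sum_parent QE rq) -mulrDr mulrC; congr (_ * _).
rewrite -[RHS]mulr1 -(t_rec (last r q)) mulrDr addrC; congr (_ + _).
rewrite mulr_sumr; apply: eq_bigr => j /up_neq /t_gt0 tj.
by rewrite expr2 !invfM -mulrA mulVKf ?gt_eqF.
Qed.

Lemma largest_eigenvalue_tree : largest_eigenvalue R node = lam.
Proof.
have [Q _] := @node_of_path [::] isT.
exact: largest_eigenvalueE Q path_weight_gt0 path_weight_eigen.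
Qed.

End Tree.

(** * The blow-up without transversal *)

Section Blowup.
Variables (R : realType) (H : sgraph) (f : labeling H).
Variables (t : 'I_#|H| -> R) (s : R) (r : 'I_#|H|).
Hypothesis f_bij : bijective f.
Hypothesis s_ge0 : 0 <= s.
Hypothesis t_root : t r = 0.
Hypothesis t_gt0 : forall i, i != r -> 0 < t i.
Hypothesis t_rec : forall i, t i + \sum_(j | up f i j) s / t j = 1.
Hypothesis r_first : val r = 0%N.

Local Notation point := ('I_#|H| * option 'I_#|H|)%type.

Definition point_weight (x : point) : R :=
  if x.2 is Some j then (if up f x.1 j then s / t j else 0) else t x.1.

Definition blocks (x y : point) : bool := (x.2 == Some y.1) && (y.2 == None).

(** Asking for positive weights isolates (r, None), and (i, Some j) for j not
above i, which would otherwise be available to a transversal. *)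
Definition point_adj : rel point := fun x y =>
  [&& 0 < point_weight x, 0 < point_weight y, adj (f x.1) (f y.1),
      ~~ blocks x y & ~~ blocks y x].

Lemma point_adj_sym : symmetric point_adj.
Proof.
move=> x y; rewrite /point_adj adj_sym andbCA; do 3!congr (_ && _).
exact: andbC.
Qed.

Lemma point_adj_irr : irreflexive point_adj.
Proof. by move=> x; rewrite /point_adj adj_irr !andbF. Qed.

Definition point_graph : sgraph := SGraph point_adj_sym point_adj_irr.

Lemma t_ge0 i : 0 <= t i.
Proof. by have [->|/t_gt0/ltW] := eqVneq i r; rewrite ?t_root. Qed.

Lemma point_weight_ge0 (x : point_graph) : 0 <= point_weight x.
Proof.
case: x => i [j|]; rewrite /point_weight /= ?t_ge0 //.
by case: ifP => // _; rewrite divr_ge0 ?t_ge0.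
Qed.

Lemma sum_cluster (F : point -> R) i :
  \sum_(x : point | f x.1 == f i) F x = \sum_o F (i, o).
Proof.
transitivity (\sum_(k | k == i) \sum_o F (k, o)); last by rewrite big_pred1_eq.
rewrite pair_big /=; apply: eq_big => [[k o]|[k o] _] //=.
by rewrite andbT (bij_eq f_bij).
Qed.

Lemma sum_fiber_weight i : \sum_o point_weight (i, o) = 1.
Proof.
rewrite (bigD1 None) //= -[RHS](t_rec i); congr (_ + _).
rewrite (reindex_omap Some id) => [|[]] //=.
rewrite [RHS]big_mkcond; apply: eq_big => j; first by rewrite eqxx.
by [].
Qed.

Lemma point_cluster_weight v :
  \sum_(x : point_graph | f x.1 == v) point_weight x = 1.
Proof.
have [g _ gK] := f_bij; rewrite -[v]gK.
by rewrite (sum_cluster point_weight) sum_fiber_weight.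
Qed.

Lemma point_cluster_nonempty v : exists x : point_graph, f x.1 = v.
Proof. by have [g _ gK] := f_bij; exists (g v, None); apply: gK. Qed.

Lemma point_adj_cluster (x y : point_graph) : adj x y -> adj (f x.1) (f y.1).
Proof. by case/and4P. Qed.

Definition slack_blowup : weighted_blowup R H :=
  WeightedBlowup point_cluster_nonempty point_adj_cluster point_weight_ge0
    point_cluster_weight.

Lemma density_sym (B : weighted_blowup R H) u v : density B u v = density B v u.
Proof.
rewrite /density.
under eq_bigr do rewrite big_mkcondr.
rewrite exchange_big; apply: eq_bigr => y _ /=; rewrite [RHS]big_mkcondr.
by apply: eq_bigr => x _; rewrite adj_sym mulrC.
Qed.

(** The only pair of positive weight missing over the edge is that of
(i, Some j) and (j, None). *)
Lemma density_up i j : up f i j -> density slack_blowup (f i) (f j) = 1 - s.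
Proof.
move=> ij; have jr : j != r.
  by case/andP: ij => ij _; apply: contraTneq ij => ->; rewrite r_first.
have ji : up f j i = false.
  by rewrite /up; case/andP: ij => /ltnW; rewrite leqNgt => /negPf->.
transitivity (\sum_o \sum_o' (point_weight (i, o) * point_weight (j, o') -
   (if (o == Some j) && (o' == None) then s else 0))).
  rewrite /density /= (sum_cluster (fun x : point =>
    \sum_(y : point | (f y.1 == f j) && point_adj x y)
      point_weight x * point_weight y)).
  apply: eq_bigr => o _; rewrite big_mkcondr (sum_cluster (fun y : point =>
    if point_adj (i, o) y then point_weight (i, o) * point_weight y else 0)).
  apply: eq_bigr => o' _; rewrite /point_adj /blocks /=.
  have [/andP[/eqP-> /eqP->]|_] := boolP ((o == Some j) && (o' == None)).
    rewrite !andbF /point_weight /= ij divfK ?subrr //.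
    by rewrite gt_eqF ?t_gt0.
  rewrite subr0; have [->|wi] := eqVneq (point_weight (i, o)) 0.
    by rewrite mul0r if_same.
  have [->|wj] := eqVneq (point_weight (j, o')) 0; first by rewrite mulr0 if_same.
  rewrite !lt_def wi wj !point_weight_ge0 (andP ij).2 /=.
  have -> : o' == Some i = false.
    by apply: contraNF wj => /eqP->; rewrite /point_weight /= ji.
  by [].
under eq_bigr do rewrite sumrB -mulr_sumr sum_fiber_weight mulr1.
rewrite sumrB sum_fiber_weight; congr (_ - _).
rewrite (bigD1 (Some j)) //= (bigD1 None) //= eqxx.
by rewrite !big1 ?addr0 // => [o /negPf->|o /negPf->]; rewrite // big1.
Qed.

(** A transversal that picks (i, Some k) cannot pick (k, None), so it picks some
(k, Some l) with l above k, and labels cannot increase for ever. *)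
Lemma slack_blowup_no_transversal :
  (exists j, up f r j) -> ~ has_transversal slack_blowup.
Proof.
move=> [j rj] [phi [phi_cluster phi_adj]].
have phi1 i : (phi (f i)).1 = i by apply: (bij_inj f_bij); apply: phi_cluster.
have up_of i l k : adj (f i) (f l) -> (phi (f i)).2 = Some k -> up f i k.
  move=> /phi_adj/and3P[]; rewrite /point_weight phi1 => + _ _ phi_i.
  by rewrite phi_i; case: ifP => //; rewrite ltxx.
have no_climb : forall i k, up f i k -> (phi (f i)).2 = Some k -> False.
  apply: (@up_ind _ (up f) val #|H| (@ltn_ord _) (@up_lt _ f)) => i IH k ik phi_i.
  have adj_ik := (andP ik).2; case phi_k: (phi (f k)).2 => [l|].
    by apply: IH ik _ (up_of _ i _ _ phi_k) phi_k; rewrite adj_sym.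
  have /and5P[_ _ _ no_block _] := phi_adj _ _ adj_ik.
  by move: no_block; rewrite /blocks phi_i phi_k (phi1 k) !eqxx.
have adj_rj := (andP rj).2; case phi_r: (phi (f r)).2 => [k|].
  exact: no_climb (up_of _ _ _ adj_rj phi_r) phi_r.
have /and3P[w_r _ _] := phi_adj _ _ adj_rj.
by move: w_r; rewrite /point_weight phi_r /= phi1 t_root ltxx.
Qed.

End Blowup.

(** * Proper labelings and the main bound *)

Section ProperLabeling.
Variables (H : sgraph) (f : labeling H).
Hypothesis f_proper : proper_labeling f.

(** The first step of a path from f i to the root, among the vertices whose
labels are at most i, leads to a neighbour with a smaller label. *)
Lemma proper_pred (i : 'I_#|H|) : (0 < i)%N -> exists j, up f j i.
Proof.
move=> i_gt0; have [f_bij f_conn] := f_proper.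
pose A := [set f j | j : 'I_#|H| & (j < i.+1)%N].
have fA (j : 'I_#|H|) : (j < i.+1)%N -> f j \in A.
  by move=> ji; rewrite imset_f ?inE.
pose o : 'I_#|H| := Ordinal (ltn_trans i_gt0 (ltn_ord i)).
pose in_A (j : 'I_#|H|) (ji : (j < i.+1)%N) : induced A :=
  exist (fun v => v \in A) _ (fA j ji).
have /connectP[p] := f_conn i.+1 (ltn_ord i) (in_A i (ltnSn i)) (in_A o (ltn0Sn i)).
case: p => [_ /(congr1 val)/(bij_inj f_bij) oi|z p zp _].
  by have := i_gt0; rewrite -[X in (_ < val X)%N]oi.
have /andP[iz _] := zp; case: z iz {zp} => z zA adj_iz.
have iz : adj (f i) z := adj_iz.
have /imsetP[j] := zA; rewrite inE ltnS => ji zE; exists j.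
rewrite /up adj_sym -zE iz andbT ltn_neqAle ji andbT.
by apply: contraTneq iz => /val_inj ji'; rewrite zE ji' adj_irr.
Qed.

(** The only candidate for a predecessor of the label 1 is the label 0. *)
Lemma proper_succ (r : 'I_#|H|) : val r = 0%N -> (exists u v : H, adj u v) ->
  exists j, up f r j.
Proof.
move=> r0 [u [v uv]]; have [[g fK gK] _] := f_proper.
have n_gt1 : (1 < #|H|)%N.
  apply/card_gt1P; exists u, v; split=> //.
  by apply: contraTneq uv => ->; rewrite adj_irr.
have [j j1] := @proper_pred (Ordinal n_gt1) isT.
exists (Ordinal n_gt1); have : j = r; last by move=> <-.
by case/andP: j1; rewrite ltnS leqn0 => /eqP j0 _; apply: val_inj; rewrite /= j0.
Qed.

End ProperLabeling.

Theorem corollary5p5 (R : realType) (H : sgraph)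
    (H_connected : connected_graph H)
    (H_edge : exists u v : H, adj u v) :
  (\big[maxe/-oo]_(f : labeling H | `[< proper_labeling f >])
     (1 - 1 / largest_eigenvalue R (monotone_path_tree f) ^+ 2)%R%:E
   <= (dcrit R H)%:E)%E.
Proof.
apply: bigmax_le => [|f /asboolP f_proper]; first exact: leNye.
have n_gt0 : (0 < #|H|)%N by have [u _] := H_edge; apply/card_gt0P; exists u.
pose r : 'I_#|H| := Ordinal n_gt0.
have has_pred (i : 'I_#|H|) : i != r -> exists j, up f j i.
  by move=> ir; apply: proper_pred => //; rewrite lt0n.
have no_pred i : ~~ up f i r by rewrite /up ltn0.
have has_succ : exists j, up f r j by apply: proper_succ.
have [s [/andP[s_gt0 s_le1] slack_r slack_gt0]] :=
  @exists_slack_root R _ (up f) val #|H| (@ltn_ord _) (@up_lt _ f) r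
    has_pred no_pred has_succ.
pose t := slack (R := R) (up f) #|H| s.
have t_rec i : t i + \sum_(j | up f i j) s / t j = 1.
  by rewrite {1}/t (slackE (@ltn_ord _) (@up_lt _ f)) subrK.
pose lam := (Num.sqrt s)^-1.
have lam_gt0 : 0 < lam by rewrite invr_gt0 sqrtr_gt0.
have lamE : lam ^- 2 = s by rewrite exprVn invrK sqr_sqrtr // ltW.
have -> : largest_eigenvalue R (monotone_path_tree f) = lam.
  by apply: (largest_eigenvalue_tree (t := t) (r := r)); rewrite ?lamE.
rewrite div1r lamE lee_fin /dcrit ub_le_sup //.
  by exists 1 => d [/andP[]].
split; first by lra.
have f_bij := f_proper.1; have [g _ gK] := f_bij.
have s_ge0 := ltW s_gt0.
exists (slack_blowup f_bij s_ge0 slack_r slack_gt0 t_rec); split; last first.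
  exact: slack_blowup_no_transversal.
move=> u v; rewrite -[u]gK -[v]gK => uv.
have [lt_uv|lt_vu|/val_inj eq_uv] := ltngtP (g u) (g v).
- by rewrite density_up // /up lt_uv.
- by rewrite density_sym density_up // /up lt_vu adj_sym.
- by rewrite eq_uv adj_irr in uv.
Qed.
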